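(* Let $\{M_1(t)\}_{t\ge0},\dots,\{M_q(t)\}_{t\ge0}$ be $q$ independent GCPs such that, for each $1\le i\le q$, $\{M_i(t)\}_{t\ge0}$ performs $k_i$ kinds of jumps of amplitude $1,2,\dots,k_i$ with positive rates $\lambda_1^{(i)},\dots,\lambda_{k_i}^{(i)}$, respectively, where $k_1\le k_2\le\cdots\le k_q$. Let $k_{(1)}<k_{(2)}<\cdots<k_{(l)}$ be the distinct values among $k_1,\dots,k_q$, let $d_m$ be the number of indices $i$ with $k_i=k_{(m)}$ (so $d_1+\dots+d_l=q$), and set $k_{(0)}=0$, $r_0=1$ and $r_m=\sum_{i=1}^{m}d_i+1$ for $1\le m\le l-1$. Then the merged process $\mathscr{M}^q(t):=M_1(t)+M_2(t)+\dots+M_q(t)$, $t\ge0$, is a GCP which performs jumps of amplitude $1,2,\dots,k_{(l)}$ with positive rates $\beta_1,\beta_2,\dots,\beta_{k_{(l)}}$, respectively, where $$\beta_j=\sum_{i=r_{m-1}}^{q}\lambda_j^{(i)}\quad\text{for } k_{(m-1)}+1\le j\le k_{(m)},\ 1\le m\le l.$$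
   Context: A counting process is an $\mathbb{N}_0$-valued process with nondecreasing right-continuous paths ($\mathbb{N}_0=\{0,1,2,\dots\}$). A generalized counting process (GCP) performing $k$ kinds of jumps of amplitude $1,2,\dots,k$ with positive rates $\lambda_1,\dots,\lambda_k$ is a counting process $\{M(t)\}_{t\ge0}$ with $M(0)=0$ and independent and stationary increments such that, as $h\to0^+$, $\mathrm{Pr}\{M(t+h)=n+j\mid M(t)=n\}$ equals $1-\sum_{i=1}^k\lambda_i h+o(h)$ for $j=0$, $\lambda_jh+o(h)$ for $1\le j\le k$, and $o(h)$ for $j\ge k+1$. *)

(* Defs.v *)
From HB Require Import structures.
From mathcomp Require Import all_boot all_order all_algebra.
From mathcomp Require Import all_classical all_reals all_analysis.

Set Implicit Arguments.
Unset Strict Implicit.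
Unset Printing Implicit Defensive.

Import Order.TTheory GRing.Theory Num.Theory.
Import numFieldNormedType.Exports.

Local Open Scope classical_set_scope.
Local Open Scope ring_scope.

Section Processes.
Context d (T : measurableType d) (R : realType) (P : probability T R).

(* Processes are indexed by [R]; only the times [t >= 0] are ever used. *)
Implicit Type X : R -> T -> nat.

Definition mutually_independent (I : finType) (F : I -> set_system T) : Prop :=
  forall (J : {set I}) (A : I -> set T),
    (forall i, i \in J -> F i (A i)) ->
    P (\bigcap_(i in [set` J]) A i) = (\prod_(i in J) P (A i))%E.

Definition process_sigma_algebra X : set_system T :=
  <<s \bigcup_(t in `[0, +oo[) preimage_set_system setT (X t) measurable >>.

Definition independent_processes (I : finType) (X : I -> R -> T -> nat) : Prop :=
  mutually_independent (fun i => process_sigma_algebra (X i)).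

(* The paths of the processes considered are nondecreasing, so that for
   [s <= t] the truncated subtraction is the usual one. *)
Definition increment X (s t : R) : T -> nat := fun w => (X t w - X s w)%N.

Definition independent_increments X : Prop :=
  forall (n : nat) (t : nat -> R),
    0 <= t 0%N -> (forall i, (i < n)%N -> t i < t i.+1) ->
    mutually_independent (fun i : 'I_n =>
      preimage_set_system setT (increment X (t i) (t i.+1)) measurable).

Definition stationary_increments X : Prop :=
  forall s t h : R, 0 <= s -> 0 <= t -> 0 <= h ->
    forall B : set nat, measurable B ->
      pushforward P (increment X s (s + h)) B =
      pushforward P (increment X t (t + h)) B.

Definition counting_process X : Prop :=
  [/\ forall t, 0 <= t -> measurable_fun setT (X t),
      forall w s t, 0 <= s -> s <= t -> (X s w <= X t w)%N
    & forall w t, 0 <= t -> X s w @[s --> t^'+] --> X t w].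

Definition cond_prob (A B : set T) : R := fine (P (A `&` B)) / fine (P B).

(* Pr{X (t + h) = n + j | X t = n} *)
Definition transition_prob X (t : R) (n j : nat) (h : R) : R :=
  cond_prob (X (t + h) @^-1` [set (n + j)%N]) (X t @^-1` [set n]).

(* The rates are [lam 1, ..., lam k]; the other values of [lam] are irrelevant.
   The transition probabilities are constrained only where the conditioning
   event is not negligible, i.e., where the conditional probability exists. *)
Definition GCP (k : nat) (lam : nat -> R) X : Prop :=
  [/\ (0 < k)%N /\ (forall j, (1 <= j <= k)%N -> 0 < lam j),
      counting_process X /\ (forall w, X 0 w = 0%N),
      independent_increments X, stationary_increments X
    & forall (t : R) (n : nat), 0 <= t -> P (X t @^-1` [set n]) != 0%E ->
      [/\ (fun h => transition_prob X t n 0 h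
             - (1 - (\sum_(1 <= i < k.+1) lam i) * h)) =o_ (0^'+) id,
          forall j, (1 <= j <= k)%N ->
            (fun h => transition_prob X t n j h - lam j * h)
              =o_ (0^'+) id
        & forall j, (k.+1 <= j)%N ->
            transition_prob X t n j =o_ (0^'+) id]].

End Processes.

Section DistinctValues.
Context (q : nat) (k : 'I_q -> nat).

Definition distinct_values : seq nat := sort leq (undup (codom k)).

Definition nb_distinct : nat := size distinct_values.

(* [kval m] is k_(m), with k_(0) = 0 *)
Definition kval (m : nat) : nat := nth 0%N (0%N :: distinct_values) m.

Definition mult (m : nat) : nat := #|[pred i : 'I_q | k i == kval m]|.

(* for [m = 0] the sum is empty, so that r_0 = 1 *)
Definition rindex (m : nat) : nat := (\sum_(1 <= i < m.+1) mult i + 1)%N.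

End DistinctValues.

(* Main.v *)
(** All the conditions on the merged process concern increments over finitely
    many intervals.  The array of the increments of the [M_i] over disjoint
    intervals is independent: across [i] because the processes are, and across
    intervals because each of them has independent increments.  An event on the
    increment of the sum is a countable disjoint union of rectangles in this
    array, so that independence and stationarity pass to the sum by countable
    additivity.  By independence and stationarity of the increments the
    transition probability from [n] to [n + j] is [Pr{X(h) = j}], which for the
    sum is the coefficient of degree [j] in the product of the (truncated)
    generating polynomials of the [M_i(h)].  Each of these polynomials is
    [1 + h * c_i + o(h)], hence the product is [1 + h * sum_i c_i + o(h)].
    Finally [r_(m-1) <= i] holds if and only if [k_i > k_(m-1)], so that
    [beta_j] is the sum of the [lambda_j^(i)] over the [i] with [j <= k_i]. *)

Require Import Defs.
From HB Require Import structures.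
From mathcomp Require Import all_boot all_order all_algebra.
From mathcomp Require Import all_classical all_reals all_analysis.

From mathcomp Require Import ring.
Import Order.TTheory GRing.Theory Num.Theory.
Import numFieldNormedType.Exports.

Local Open Scope classical_set_scope.
Local Open Scope ring_scope.

(** * The rates [beta_j] *)

Lemma card_ord_ltn (q m : nat) :
  (m <= q)%N -> #|[pred j : 'I_q | (j < m)%N]| = m.
Proof.
move=> mq; rewrite -sum1_card (eq_bigl (fun j : 'I_q => (j < m)%N))//.
by rewrite (big_ord_narrow mq) sum1_card card_ord.
Qed.

Section DistinctValuesTheory.
Context (q : nat) (k : 'I_q -> nat).
Hypothesis k_gt0 : forall i, (0 < k i)%N.

Lemma kval0 : kval k 0 = 0%N.
Proof. by []. Qed.

Lemma mem_distinct_values (v : nat) :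
  (v \in distinct_values k) = (v \in codom k).
Proof. by rewrite mem_sort mem_undup. Qed.

(** The distinct values are sorted without repetition, and positivity of all [k i] keeps the list
    strictly increasing once [0] is put in front. *)
Lemma kval_ltn (a b : nat) :
  (a < b)%N -> (b <= nb_distinct k)%N -> (kval k a < kval k b)%N.
Proof.
move=> ab bk.
have s0 : sorted ltn (0%N :: distinct_values k).
  rewrite /= path_min_sorted; last first.
    by apply/allP => v; rewrite mem_distinct_values => /codomP[i ->]; exact: k_gt0.
  by rewrite ltn_sorted_uniq_leq sort_uniq undup_uniq sort_sorted//; exact: leq_total.
apply: (sorted_ltn_nth ltn_trans 0%N s0) => //.
by rewrite inE /= ltnS; apply: leq_trans bk; exact: ltnW.
Qed.

Lemma kval_leq (a b : nat) :
  (a <= b)%N -> (b <= nb_distinct k)%N -> (kval k a <= kval k b)%N.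
Proof. by rewrite leq_eqVlt => /orP[/eqP-> //|ab] bk; apply/ltnW/kval_ltn. Qed.

Lemma kvalP (i : 'I_q) :
  exists2 m, (0 < m <= nb_distinct k)%N & k i = kval k m.
Proof.
have ki : k i \in distinct_values k by rewrite mem_distinct_values codom_f.
exists (index (k i) (distinct_values k)).+1.
  by rewrite /= /nb_distinct index_mem.
by rewrite /kval /= nth_index.
Qed.

Lemma kval_codom (m : nat) :
  (0 < m <= nb_distinct k)%N -> exists i, k i = kval k m.
Proof.
case: m => //= m mk.
have : kval k m.+1 \in distinct_values k by rewrite /kval /= mem_nth.
by rewrite mem_distinct_values => /codomP[i ->]; exists i.
Qed.

Lemma nb_distinct_gt0 : (0 < q)%N -> (0 < nb_distinct k)%N.
Proof. by move=> q0; have [m /andP[m0 /(leq_trans m0)]] := kvalP (Ordinal q0). Qed.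

Lemma leq_kval_nb (i : 'I_q) : (k i <= kval k (nb_distinct k))%N.
Proof. by have [m /andP[_ mk] ->] := kvalP i; exact: kval_leq. Qed.

(** Induction on [m]: no value lies strictly between two consecutive [kval], so passing from [m] to
    [m.+1] adds exactly the disjoint class of indices where [k] equals [kval k m.+1]. *)
Lemma sum_mult (m : nat) : (m <= nb_distinct k)%N ->
  (\sum_(1 <= a < m.+1) mult k a)%N = #|[pred i | (k i <= kval k m)%N]|.
Proof.
elim: m => [|m IH] mk.
  rewrite big_geq// eq_card0// => i; rewrite !inE kval0 leqn0.
  by apply/negbTE; rewrite -lt0n.
rewrite big_nat_recr//= IH; last exact: ltnW.
rewrite -cardUI [X in (_ + X)%N]eq_card0 ?addn0.
  apply: eq_card => i; rewrite !inE.
  have mm := kval_ltn m m.+1 (ltnSn _) mk.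
  have [a /andP[_ ak] ->] := kvalP i.
  apply/orP/idP => [[/leq_trans->//|/eqP->//]|].
    exact: ltnW.
  case: (leqP a m) => [am _|]; first by left; apply: kval_leq => //; exact: ltnW.
  rewrite leq_eqVlt => /orP[/eqP<- _|ma]; first by right.
  by rewrite leqNgt kval_ltn.
move=> i; rewrite !inE; apply/negbTE/negP => /andP[ki /eqP kE].
by move: ki; rewrite kE leqNgt kval_ltn.
Qed.

(** As [k] is nondecreasing, the indices with [k j <= kval k m] form an initial segment, of
    cardinality [rindex k m - 1]. It is compared with the segments of lengths [i.+1] and [i]. *)
Lemma rindex_leq (m : nat) (i : 'I_q) :
    (forall i j : 'I_q, (i <= j)%N -> (k i <= k j)%N) ->
    (m <= nb_distinct k)%N ->
  (rindex k m <= i.+1)%N = (kval k m < k i)%N.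
Proof.
move=> k_ndec mk; rewrite /rindex addn1 ltnS sum_mult// [RHS]ltnNge.
apply/idP/negP => [cardi ki|/negP].
  have : (#|[pred j : 'I_q | (j < i.+1)%N]| <= #|[pred j | (k j <= kval k m)%N]|)%N.
    apply/subset_leq_card/fintype.subsetP => j; rewrite !inE ltnS => ji.
    exact: leq_trans (k_ndec _ _ ji) ki.
  have -> : #|[pred j : 'I_q | (j < i.+1)%N]| = i.+1.
    exact: card_ord_ltn.
  by rewrite ltnNge cardi.
rewrite -ltnNge => ki.
have <- : #|[pred j : 'I_q | (j < i)%N]| = i.
  exact/card_ord_ltn/ltnW.
apply/subset_leq_card/fintype.subsetP => j; rewrite !inE => kj.
rewrite ltnNge; apply/negP => /k_ndec.
by rewrite leqNgt (leq_ltn_trans kj ki).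
Qed.

(** This removes the block structure from the rates. For the least block whose upper end
    [kval k m.+1] reaches [j], no [k i] lies strictly between [kval k m] and [kval k m.+1], so
    [kval k m < k i] amounts to [j <= k i]. *)
Lemma merged_rateE (R : realType) (lam : 'I_q -> nat -> R) (beta : nat -> R) :
    (forall i j : 'I_q, (i <= j)%N -> (k i <= k j)%N) ->
    (forall m j : nat, (1 <= m <= nb_distinct k)%N ->
      (kval k m.-1 + 1 <= j <= kval k m)%N ->
      beta j = \sum_(i < q | (rindex k m.-1 <= i.+1)%N) lam i j) ->
  forall j, (1 <= j <= kval k (nb_distinct k))%N ->
    beta j = \sum_(i < q | (j <= k i)%N) lam i j.
Proof.
move=> k_ndec betaE j /andP[j0 jk].
have [] := @ex_minnP (fun m => j <= kval k m)%N; first by exists (nb_distinct k).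
case=> [|m]; first by rewrite kval0 leqNgt j0.
move=> jm min_m.
have mk : (m < nb_distinct k)%N by exact: min_m.
have mj : (kval k m < j)%N.
  by rewrite ltnNge; apply/negP => /min_m; rewrite ltnn.
rewrite (betaE m.+1)//=; last by rewrite addn1 mj.
apply: eq_bigl => i; rewrite rindex_leq//; last exact: ltnW.
apply/idP/idP => [|/(leq_trans mj)//].
have [a /andP[_ ak] ->] := kvalP i => ma.
apply: leq_trans jm _; apply: kval_leq => //.
rewrite ltnNge; apply/negP => /kval_leq => /(_ (ltnW mk)).
by rewrite leqNgt ma.
Qed.

End DistinctValuesTheory.

(** * First-order expansions at 0+ *)

Section FirstOrderExpansion.
Context (R : realType).
Implicit Types (f g : R -> R) (a b : R).

(* [f h = a + b * h + o(h)] as [h -> 0+] *)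
Definition expands f a b : Prop := (fun h => (f h - a) / h) @ 0^'+ --> b.

(** Both sides bound the same quantity, since the distance from the quotient to [b] is [|g h| / h].
    The link between [g] and [f] is asked only for [h > 0], where transition probabilities will be
    computed. *)
Lemma eqo_expands f a b g :
  (forall h, 0 < h -> g h = f h - (a + b * h)) ->
  g =o_ (0^'+) id <-> expands f a b.
Proof.
move=> gE.
have normE h : 0 < h -> `|b - (f h - a) / h| = `|g h| / h.
  move=> h0; have -> : b - (f h - a) / h = - (g h / h).
    by rewrite gE//; field; rewrite gt_eqF.
  by rewrite normrN normrM normfV (gtr0_norm h0).
split=> [/eqoP go|fab].
  apply/cvgrPdist_le => e e0; have := go e e0.
  apply: filterS2 (nbhs_right_gt 0) => h h0.
  by rewrite normE// ler_pdivrMr// [`|id h|]gtr0_norm.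
apply/eqoP => e e0; move/cvgrPdist_le : fab => /(_ _ e0).
apply: filterS2 (nbhs_right_gt 0) => h h0.
by rewrite normE// ler_pdivrMr// [`|id h|]gtr0_norm.
Qed.

Lemma expands_cst a : expands (fun=> a) a 0.
Proof.
rewrite /expands (_ : (fun _ => _) = cst 0); first exact: cvg_cst.
by apply/funext => h /=; rewrite subrr mul0r.
Qed.

Lemma expands_cvg f a b : expands f a b -> f @ 0^'+ --> a.
Proof.
move=> fab; have id0 : (h : R) @[h --> 0^'+] --> (0 : R).
  by apply: cvg_at_right_filter; exact: cvg_id.
have := cvgD (cvgM fab id0) (cvg_cst a); rewrite mulr0 add0r => fa.
apply: cvg_trans (fa _ _ _); apply: near_eq_cvg.
apply: filterS (nbhs_right_gt 0) => h h0 /=.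
change ((f h - a) / h * h + a = f h).
by rewrite mulfVK ?gt_eqF// subrK.
Qed.

(** The product rule: the quotient of [f * g] splits as [a] times that of [g] plus that of [f] times
    [g h], and [g h] tends to [a']. *)
Lemma expandsM f g a b a' b' : expands f a b -> expands g a' b' ->
  expands (fun h => f h * g h) (a * a') (a * b' + b * a').
Proof.
move=> fab gab; rewrite /expands.
have fg := cvgD (cvgM (cvg_cst a) gab) (cvgM fab (expands_cvg _ _ _ gab)).
apply: cvg_trans (fg _ _ _ _); apply: near_eq_cvg; apply: nearW => h /=.
change (a * ((g h - a') / h) + (f h - a) / h * g h =
  (f h * g h - a * a') / h).
by ring.
Qed.

Lemma expands_sum (I : Type) (r : seq I) (f : I -> R -> R) (a b : I -> R) :
    (forall i, expands (f i) (a i) (b i)) ->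
  expands (fun h => \sum_(i <- r) f i h) (\sum_(i <- r) a i) (\sum_(i <- r) b i).
Proof.
move=> fab; elim: r => [|i r IH].
  rewrite !big_nil; under eq_fun do rewrite big_nil.
  exact: expands_cst.
rewrite !big_cons; under eq_fun do rewrite big_cons.
have fS := cvgD (fab i) IH; rewrite /expands.
apply: cvg_trans (fS _); apply: near_eq_cvg; apply: nearW => h /=.
set S := (\sum_(j <- r) f j h); set A := (\sum_(j <- r) a j).
change ((f i h - a i) / h + (S - A) / h = (f i h + S - (a i + A)) / h).
by ring.
Qed.

(* The constant terms are those of the polynomial 1, so that only the terms
   with a single non-constant factor contribute to the first order. *)
Lemma expands_coef_prod (I : Type) (r : seq I) (G : I -> R -> {poly R})
    (c : I -> nat -> R) (n : nat) :
    (forall p i, (i <= n)%N ->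
      expands (fun h => (G p h)`_i) (i == 0%N)%:R (c p i)) ->
  forall i, (i <= n)%N ->
    expands (fun h => (\prod_(p <- r) G p h)`_i) (i == 0%N)%:R
      (\sum_(p <- r) c p i).
Proof.
move=> GE; elim: r => [|p r IH] i ni.
  rewrite big_nil; under eq_fun do rewrite big_nil coef1.
  exact: expands_cst.
rewrite big_cons; under eq_fun do rewrite big_cons coefM.
set F := fun h => \prod_(p <- r) G p h; set C := fun i => \sum_(p <- r) c p i.
rewrite -/(C i).
(* Constant terms and slopes are rewritten as convolutions with the shape of [coefM], so that the
   product rule applies summand by summand. In the slopes, only the extreme indices [j = 0] and
   [j = i] contribute. *)
have -> : (i == 0%N)%:R = \sum_(j < i.+1) (j == 0%N :> nat)%:R * ((i - j)%N == 0%N)%:R :> R.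
  rewrite big_ord_recl/= mul1r subn0 big1 ?addr0// => j _.
  by rewrite mul0r.
have -> : c p i + C i =
    \sum_(j < i.+1) ((j == 0%N :> nat)%:R * C (i - j)%N + c p j * ((i - j)%N == 0%N)%:R).
  rewrite big_split/= [RHS]addrC; congr (_ + _).
    by rewrite big_ord_recr/= subnn mulr1 big1 ?add0r// => j _;
      rewrite subn_eq0 leqNgt ltn_ord mulr0.
  by rewrite big_ord_recl/= mul1r subn0 big1 ?addr0// => j _; rewrite mul0r.
apply: expands_sum => j; apply: expandsM.
  by apply: GE; rewrite (leq_trans _ ni)// -ltnS.
by apply: IH; rewrite (leq_trans _ ni)// leq_subr.
Qed.

End FirstOrderExpansion.

(** * Independence *)

Section CountableUnions.
Context {T : Type}.
Implicit Types F G : set_system T.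

(** Independence extends to this class by countable additivity alone, without a monotone class
    argument. *)
Definition countable_disjoint_unions F : set_system T :=
  [set A | exists B : nat -> set T,
    [/\ forall n, F (B n), trivIset setT B & A = \bigcup_n B n]].

(** The fibers of [D] over [E] are indexed by [nat] through the coding of [U]; an integer coding no
    element gives the empty set. *)
Definition fiber {U : countType} (D : T -> U) (E : set U) (n : nat) : set T :=
  if pickle_inv n is Some u then D @^-1` ([set u] `&` E) else set0.

Lemma set1I_or {U : Type} (E : set U) (u : U) :
  [set u] `&` E = [set u] \/ [set u] `&` E = set0.
Proof.
have [Eu|Eu] := pselect (E u); [left|right].
  by apply: setIidl => _ ->.
by apply/seteqP; split=> // _ [-> /Eu].
Qed.

Lemma trivIset_fiber {U : countType} (D : T -> U) (E : set U) :
  trivIset setT (fiber D E).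
Proof.
apply/trivIsetP => m n _ _ mn; rewrite /fiber.
case mE : (pickle_inv m) => [u|]; last by rewrite set0I.
case nE : (pickle_inv n) => [v|]; last by rewrite setI0.
apply/seteqP; split=> [w|//] [[/= uw _] [/= vw _]].
have := pickle_invK (T := U) m; have := pickle_invK (T := U) n.
by rewrite mE nE /= -uw -vw => nD mD; rewrite -mD nD eqxx in mn.
Qed.

Lemma bigcup_fiber {U : countType} (D : T -> U) (E : set U) :
  \bigcup_n fiber D E n = D @^-1` E.
Proof.
apply/seteqP; split=> [w [n _]|w Ew].
  by rewrite /fiber; case: pickle_inv => // u [].
by exists (pickle (D w)) => //; rewrite /fiber pickleK_inv.
Qed.

Lemma preimage_countable_disjoint_unions {U : countType} (D : T -> U)
    (E : set U) F :
    F set0 -> (forall u, F (D @^-1` [set u])) ->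
  countable_disjoint_unions F (D @^-1` E).
Proof.
move=> F0 FD; exists (fiber D E); split.
- move=> n; rewrite /fiber; case: pickle_inv => // u.
  by case: (set1I_or E u) => ->; rewrite ?preimage_set0.
- exact: trivIset_fiber.
- by rewrite bigcup_fiber.
Qed.

End CountableUnions.

Section Independence.
Context d (T : measurableType d) (R : realType) (P : probability T R).

Lemma eq_probability_preimage (U : countType) (D D' : T -> U) (E : set U) :
    (forall u, measurable (D @^-1` [set u])) ->
    (forall u, measurable (D' @^-1` [set u])) ->
    (forall u, P (D @^-1` [set u]) = P (D' @^-1` [set u])) ->
  P (D @^-1` E) = P (D' @^-1` E).
Proof.
move=> mD mD' DD'.
have mfiber (X : T -> U) n : (forall u, measurable (X @^-1` [set u])) ->
    measurable (fiber X E n).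
  move=> mX; rewrite /fiber; case: pickle_inv => // u.
  by case: (set1I_or E u) => ->; rewrite ?preimage_set0.
have sumE (X : T -> U) : (forall u, measurable (X @^-1` [set u])) ->
    P (X @^-1` E) = (\sum_(n <oo) P (fiber X E n))%E.
  move=> mX; rewrite -[in LHS]bigcup_fiber measure_semi_bigcup//.
  - by move=> n; exact: mfiber.
  - exact: trivIset_fiber.
  - by apply: bigcup_measurable => n _; exact: mfiber.
rewrite !sumE//; apply: eq_eseriesr => n _; rewrite /fiber.
case: pickle_inv => // u.
by case: (set1I_or E u) => ->; rewrite ?preimage_set0.
Qed.

Lemma mutually_independent_sub (I : finType) (F G : I -> set_system T) :
    (forall i, G i `<=` F i) ->
  mutually_independent P F -> mutually_independent P G.
Proof. by move=> GF indF J A GA; apply: indF => i /GA /GF. Qed.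

Lemma bigcap_finset_setD1 (I : finType) (J : {set I}) (a : I) (A : I -> set T) :
    a \in J ->
  \bigcap_(i in [set` J]) A i = A a `&` \bigcap_(i in [set` J :\ a]) A i.
Proof.
move=> aJ; rewrite (bigcap_setD1 a)//; congr (_ `&` _).
rewrite (_ : [set` J :\ a] = [set` J] `\ a)//.
apply/seteqP; split=> i /=; first by rewrite !inE => /andP[/eqP ia iJ].
by move=> [iJ /eqP ia]; rewrite !inE ia iJ.
Qed.

(** The events at the other indices are gathered into one event [C]; the product formula holds for
    each piece [B n] together with [C], and is then summed over [n]. *)
Lemma mutually_independent_update (I : finType) (F : I -> set_system T)
    (a : I) (G : set_system T) :
    (forall i, F i `<=` measurable) ->
    G `<=` countable_disjoint_unions (F a) ->
    mutually_independent P F ->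
  mutually_independent P (fun i => if i == a then G else F i).
Proof.
move=> mF GF indF J A FA; have [aJ|aJ] := boolP (a \in J); last first.
  apply: indF => i iJ; have := FA _ iJ.
  by case: eqP => // ia; rewrite -ia iJ in aJ.
have := FA _ aJ; rewrite eqxx => /GF[B [FB tB AB]].
have FA' i : i \in J :\ a -> F i (A i).
  by rewrite !inE => /andP[/negbTE ia /FA]; rewrite ia.
rewrite (bigcap_finset_setD1 _ _ a)// (big_setD1 a)//=.
rewrite -indF//; set C := \bigcap_(i in _) A i.
have mC : measurable C.
  by apply: fin_bigcap_measurable => [|i /FA' /mF//]; exact: finite_finset.
have mB n : measurable (B n) by exact: mF (FB n).
have PBC n : P (B n `&` C) = (P C * P (B n))%E.
  (* Putting [B n] at index [a] gives a family inside [F], to which the assumed independence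
     applies. *)
  pose A' i := if i == a then B n else A i.
  have CE : C = \bigcap_(i in [set` J :\ a]) A' i.
    by apply: eq_bigcapr => i; rewrite /= !inE /A' => /andP[/negbTE->].
  have A'a : A' a = B n by rewrite /A' eqxx.
  have FA'' i : i \in J -> F i (A' i).
    move=> iJ; rewrite /A'; case: eqVneq => [->//|ia].
    by apply: FA'; rewrite !inE ia.
  rewrite CE -A'a -(bigcap_finset_setD1 _ _ a)// !indF//; last first.
    by move=> i; rewrite !inE => /andP[_ /FA''].
  by rewrite (big_setD1 a)//= muleC.
rewrite AB setI_bigcupl measure_semi_bigcup//; last 3 first.
- by move=> n; exact: measurableI.
- apply/trivIsetP => m n _ _ mn; rewrite setIACA.
  by move/trivIsetP : tB => ->//; rewrite set0I.
- by apply: bigcup_measurable => n _; exact: measurableI.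
rewrite measure_semi_bigcup//; last by exact: bigcup_measurable.
(* Finiteness of [P C] turns it into a real constant, which can be pulled out of the series. *)
have PCE : (fine (P C))%:E = P C by rewrite fineK// fin_num_measure.
transitivity (\sum_(n <oo) (fine (P C))%:E * P (B n))%E.
  by apply: eq_eseriesr => n _; rewrite PCE; exact: PBC.
by rewrite nneseriesZl// PCE muleC.
Qed.

Lemma mutually_independent_countable_disjoint_unions (I : finType)
    (F G : I -> set_system T) :
    (forall i, F i `<=` measurable) ->
    (forall i, G i `<=` countable_disjoint_unions (F i)) ->
    mutually_independent P F ->
  mutually_independent P G.
Proof.
move=> mF GF indF.
(* The systems [F i] are replaced by [G i] one index at a time along an enumeration of [I]. *)
suff H (s : seq I) : uniq s ->
    mutually_independent P (fun i => if i \in s then G i else F i).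
  apply: mutually_independent_sub (H _ (enum_uniq I)) => i.
  by rewrite mem_enum.
elim: s => [_|a s IH /= /andP[as_ us]].
  by apply: mutually_independent_sub indF => i.
have := @mutually_independent_update _ _ a (G a) _ _ (IH us).
rewrite (negbTE as_) => /(_ _ (GF a)) H.
apply: mutually_independent_sub (H _) => [i|i].
  by rewrite inE; case: eqVneq => [->|_] A.
case: ifP => _; last exact: mF.
move=> A /GF[B [FB _ ->]]; apply: bigcup_measurable => n _.
exact: mF (FB n).
Qed.

End Independence.

(** * Sums over the rows of an independent array *)

Section Rectangles.
Context d (T : measurableType d) (R : realType) (P : probability T R).
Context (I J : finType) (X : I -> J -> T -> nat).

Lemma bigcap_preimage_ffun (u : {ffun I -> nat}) (j : J) :
  (fun w => [ffun p => X p j w]) @^-1` [set u] =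
  \bigcap_(p in [set` [set: I]%SET]) X p j @^-1` [set u p].
Proof.
apply/seteqP; split=> w /=; first by move=> <- p _; rewrite /= ffunE.
by move=> wu; apply/ffunP => p; rewrite ffunE; apply: wu; rewrite /= inE.
Qed.

Definition rectangles (j : J) : set_system T :=
  [set A | exists C : I -> set nat,
    A = \bigcap_(p in [set` [set: I]%SET]) X p j @^-1` C p].

(* Each [S p] stands for the sigma-algebra of the whole process [p], of which
   the [X p j] are the increments. *)
Context (S : I -> set_system T).
Hypothesis S_indep : mutually_independent P S.
Hypothesis S_bigcap : forall p (K : {set J}) (C : J -> set nat),
  S p (\bigcap_(j in [set` K]) X p j @^-1` C j).
Hypothesis X_indep : forall p,
  mutually_independent P (fun j => preimage_set_system setT (X p j) measurable).

Lemma S_preimage p j (C : set nat) : S p (X p j @^-1` C).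
Proof.
have := S_bigcap p [set j]%SET (fun=> C).
rewrite (_ : \bigcap_(_ in _) _ = X p j @^-1` C)//.
apply/seteqP; split=> w /=; first by apply; rewrite /= inE.
by move=> Cw i /=; rewrite inE => /eqP->.
Qed.

Lemma probability_rectangle (j : J) (C : I -> set nat) :
  P (\bigcap_(p in [set` [set: I]%SET]) X p j @^-1` C p) =
  (\prod_(p in [set: I]%SET) P (X p j @^-1` C p))%E.
Proof. by apply: S_indep => p _; exact: S_preimage. Qed.

(** The intersection is regrouped by process: [S_indep] factors it across [p], [X_indep] factors
    each part across [j], and the double product is exchanged. *)
Lemma rectangles_independent : mutually_independent P rectangles.
Proof.
move=> K A recA.
have /choice[C AC] j : exists C : I -> set nat, j \in K ->
    A j = \bigcap_(p in [set` [set: I]%SET]) X p j @^-1` C p.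
  have [/recA[C AC]|_] := boolP (j \in K); first by exists C.
  by exists (fun=> set0).
transitivity (P (\bigcap_(p in [set` [set: I]%SET])
    \bigcap_(j in [set` K]) X p j @^-1` C j p)).
  congr (P _); apply/seteqP; split=> w Aw.
    by move=> p pI j jK; have := Aw _ jK; rewrite AC// => /(_ p pI).
  by move=> j /= jK; rewrite AC// => p pI; exact: Aw.
rewrite S_indep => [|p _]; last exact: S_bigcap.
transitivity (\prod_(p in [set: I]%SET) \prod_(j in K) P (X p j @^-1` C j p))%E.
  apply: eq_bigr => p _; rewrite (X_indep p K (fun j => X p j @^-1` C j p))// => j _.
  by exists (C j p) => //; rewrite setTI.
rewrite exchange_big; apply: eq_bigr => j jK.
by rewrite AC// probability_rectangle.
Qed.

(** The vector of summands takes countably many values, so an event on the sum is a countable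
    disjoint union of one-point rectangles. *)
Lemma sum_independent : (0 < #|I|)%N ->
    (forall p j, measurable_fun setT (X p j)) ->
  mutually_independent P (fun j =>
    preimage_set_system setT (fun w => \sum_p X p j w)%N measurable).
Proof.
move=> /card_gt0P[p0 _] mX.
apply: (@mutually_independent_countable_disjoint_unions _ _ _ _ _ rectangles
  _ _ _ rectangles_independent).
  move=> j _ [C ->]; apply: fin_bigcap_measurable => [|p _].
    exact: finite_finset.
  by rewrite -[X in measurable X]setTI; exact: mX.
move=> j _ [B _ <-]; rewrite setTI.
rewrite (_ : _ @^-1` B = (fun w => [ffun p => X p j w]) @^-1`
    [set u : {ffun I -> nat} | B (\sum_p u p)%N]); last first.
  apply/funext => w /=; congr (B _).
  by apply: eq_bigr => p _; rewrite ffunE.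
apply: preimage_countable_disjoint_unions => [|u].
  (* The coordinate [p0] makes the empty event a rectangle; an intersection over no coordinate would
     be the whole space. *)
  exists (fun=> set0); apply/seteqP; split=> // w /(_ p0); apply.
  by rewrite /= inE.
by exists (fun p => [set u p]); rewrite bigcap_preimage_ffun.
Qed.

End Rectangles.

(** * Law of a finite independent sum through generating polynomials *)

Section SumDistribution.
Context d (T : measurableType d) (R : realType) (P : probability T R).
Context (I : finType) (Y : I -> T -> nat).
Hypothesis mY : forall p, measurable_fun setT (Y p).
Hypothesis Y_indep : forall u : I -> nat,
  P (\bigcap_(p in [set` [set: I]%SET]) Y p @^-1` [set u p]) =
  (\prod_(p in [set: I]%SET) P (Y p @^-1` [set u p]))%E.

(** Truncation at degree [n] loses nothing: summands of a total [j <= n] are at most [n].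
    Distributing the product over the choices [u] of exponents matches the decomposition of the
    event according to the values of all [Y p]. *)
Lemma probability_sum_coef (n j : nat) : (j <= n)%N ->
  fine (P ((fun w => \sum_p Y p w)%N @^-1` [set j])) =
  (\prod_p \poly_(m < n.+1) fine (P (Y p @^-1` [set m])))`_j.
Proof.
move=> jn.
have mYm p m : measurable (Y p @^-1` [set m]).
  by rewrite -[X in measurable X]setTI; exact: mY.
pose F (u : {ffun I -> 'I_n.+1}) :=
  \bigcap_(p in [set` [set: I]%SET]) Y p @^-1` [set u p : nat].
pose D := [set u : {ffun I -> 'I_n.+1} | (\sum_p u p)%N = j].
have -> : (fun w => \sum_p Y p w)%N @^-1` [set j] = \bigcup_(u in D) F u.
  apply/seteqP; split=> w /=; last first.
    move=> [u /= <- wu]; apply: eq_bigr => p _.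
    by apply: wu; rewrite /= inE.
  move=> wj; have Yn p : (Y p w < n.+1)%N.
    by rewrite ltnS (leq_trans _ jn)// -wj (bigD1 p)//= leq_addr.
  exists [ffun p => Ordinal (Yn p)].
    by rewrite /D /= -[RHS]wj; apply: eq_bigr => p _; rewrite ffunE.
  by move=> p _ /=; rewrite ffunE.
rewrite measure_fin_bigcup//; first last.
- by move=> u _; apply: fin_bigcap_measurable => [|p _//]; exact: finite_finset.
- move=> u v _ _ [w [wu wv]]; apply/ffunP => p; apply/val_inj => /=.
  by rewrite -(wu p) -?(wv p)//= inE.
- exact: finite_finset.
have DE u : (u \in D) = (j == \sum_p u p)%N.
  by apply/idP/eqP => [/set_mem <-//|ju]; apply/mem_set.
rewrite (fsbigE [seq u <- index_enum {ffun I -> 'I_n.+1} | u \in D]); last 3 first.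
- by rewrite filter_uniq// index_enum_uniq.
- by move=> u /=; rewrite mem_filter => /andP[/set_mem].
- by move=> u /mem_set Du; rewrite mem_filter Du mem_index_enum.
rewrite big_filter_cond.
under [in RHS]eq_bigr do rewrite poly_def.
rewrite bigA_distr_bigA coef_sum /=.
under [in RHS]eq_bigr do rewrite scaler_prod prodrXr coefZ coefXn.
rewrite -sum_fine; last first.
  move=> u _; apply: fin_num_measure; apply: fin_bigcap_measurable => [|p _//].
  exact: finite_finset.
rewrite big_mkcond /=; apply: eq_bigr => u _.
rewrite andbb DE; case: eqP => _; last by rewrite mulr0.
rewrite mulr1 /F Y_indep.
rewrite (eq_bigr (fun p => (fine (P (Y p @^-1` [set u p : nat])))%:E)).
  by rewrite prodEFin; apply: eq_bigl => p; rewrite inE.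
by move=> p _; rewrite fineK// fin_num_measure.
Qed.

End SumDistribution.

(** * Increments and transition probabilities of a single process *)

Section Processes.
Context d (T : measurableType d) (R : realType) (P : probability T R).
Implicit Types X : R -> T -> nat.

Lemma process_sigma_algebra_preimage X (t : R) (B : set nat) :
  0 <= t -> process_sigma_algebra X (X t @^-1` B).
Proof.
move=> t0; apply: sub_gen_smallest; exists t; first by rewrite /= in_itv/= t0.
by exists B => //; rewrite setTI.
Qed.

Lemma process_sigma_algebra_bigcap X (I : finType) (K : {set I}) (A : I -> set T) :
    (forall i, process_sigma_algebra X (A i)) ->
  process_sigma_algebra X (\bigcap_(i in [set` K]) A i).
Proof.
move=> XA; apply: (@fin_bigcap_measurable _ (g_sigma_algebraType
  (\bigcup_(t in `[0, +oo[) preimage_set_system setT (X t) measurable)))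
    => [|i _]; [exact: finite_finset|exact: XA].
Qed.

Lemma process_sigma_algebra_increment X (s t : R) (B : set nat) :
  0 <= s -> 0 <= t -> process_sigma_algebra X (increment X s t @^-1` B).
Proof.
move=> s0 t0; rewrite (_ : _ @^-1` B = \bigcup_a
    (X s @^-1` [set a] `&` X t @^-1` [set b | B (b - a)%N])); last first.
  apply/seteqP; split=> [w Bw|w [a _ [/= <-]]//].
  by exists (X s w).
pose G := \bigcup_(t in `[0, +oo[) preimage_set_system setT (X t) measurable.
apply: (@bigcup_measurable _ (g_sigma_algebraType G)) => a _.
by apply: (@measurableI _ (g_sigma_algebraType G));
  exact: process_sigma_algebra_preimage.
Qed.

Lemma measurable_increment X (s t : R) :
    measurable_fun setT (X s) -> measurable_fun setT (X t) ->
  measurable_fun setT (increment X s t).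
Proof.
move=> mXs mXt _ B _; rewrite setTI.
rewrite (_ : _ @^-1` B = \bigcup_a
    (X s @^-1` [set a] `&` X t @^-1` [set b | B (b - a)%N])); last first.
  apply/seteqP; split=> [w Bw|w [a _ [/= <-]]//].
  by exists (X s w).
apply: bigcup_measurable => a _.
by apply: measurableI; rewrite -[X in measurable X]setTI; [exact: mXs|exact: mXt].
Qed.

Lemma independent_increments2 X (t h : R) (A B : set nat) :
    independent_increments P X -> 0 < t -> 0 < h ->
  P (increment X 0 t @^-1` A `&` increment X t (t + h) @^-1` B) =
  (P (increment X 0 t @^-1` A) * P (increment X t (t + h) @^-1` B))%E.
Proof.
move=> indX t0 h0; pose u i : R := nth (t + h) [:: 0; t] i.
have u_incr i : (i < 2)%N -> u i < u i.+1.
  by case: i => [|[|]]//= _; rewrite /u/= ltrDl.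
have := indX 2%N u (lexx _) u_incr [set: 'I_2]%SET
  (fun i => increment X (u i) (u i.+1) @^-1` (if i == ord0 then A else B)).
rewrite (_ : \bigcap_(_ in _) _ =
    increment X 0 t @^-1` A `&` increment X t (t + h) @^-1` B).
  rewrite (eq_bigl xpredT); last by move=> i; rewrite inE.
  rewrite !big_ord_recl big_ord0 mule1 => ->// i _.
  by eexists; last by rewrite setTI.
apply/seteqP; split=> w /=.
  by move=> uw; split; [have := uw ord0|have := uw ord_max]; rewrite /= inE; apply.
by move=> [wA wB] [[|[|]]].
Qed.

(** The joint event is an event on the increments over the intervals from [0] to [t] and from [t] to
    [t + h]; independence cancels the first factor and stationarity moves the second to time [0]. *)
Lemma transition_probE X (t h : R) (n j : nat) :
    counting_process X -> (forall w, X 0 w = 0%N) ->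
    independent_increments P X -> stationary_increments P X ->
    0 <= t -> 0 < h -> P (X t @^-1` [set n]) != 0%E ->
  transition_prob P X t n j h = fine (P (X h @^-1` [set j])).
Proof.
move=> [mX ndecX _] X0 indX statX t0 h0 PXt.
have mXt s (B : set nat) : 0 <= s -> measurable (X s @^-1` B).
  by move=> s0; rewrite -[X in measurable X]setTI; exact: mX.
have inc0 s : increment X 0 s = X s.
  by apply/funext => w; rewrite /increment X0 subn0.
have Ph : P (X h @^-1` [set j]) = P (increment X t (t + h) @^-1` [set j]).
  have := statX 0 t h (lexx _) t0 (ltW h0) [set j].
  by rewrite add0r inc0 /pushforward => ->.
rewrite /transition_prob /cond_prob.
have -> : X (t + h) @^-1` [set (n + j)%N] `&` X t @^-1` [set n] =
    increment X 0 t @^-1` [set n] `&` increment X t (t + h) @^-1` [set j].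
  rewrite inc0; apply/seteqP; split=> w /=.
    by move=> [Xth Xtn]; split=> //; rewrite /increment Xth Xtn addKn.
  move=> [Xtn <-]; split=> //; rewrite /increment -Xtn subnKC//.
  by apply: ndecX => //; rewrite lerDl ltW.
(* Independent increments are stated for strictly increasing times, so [t = 0] is separate: there
   [n = 0] and the conditioning event is the whole space. *)
have [{}t0|t_gt0|t00] := ltgtP 0 t; last 2 first.
- by rewrite ltNge t0 in t_gt0.
- have n0 : n = 0%N.
    apply/eqP; apply: contra_neqT PXt => n0.
    rewrite (_ : _ @^-1` _ = set0) ?measure0//.
    by apply/seteqP; split=> // w /=; rewrite -t00 X0 => /esym/eqP; rewrite (negbTE n0).
  rewrite n0 -t00 inc0 (_ : X 0 @^-1` _ = setT); last first.
    by apply/seteqP; split=> // w _ /=; rewrite X0.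
  by rewrite setTI probability_setT divr1 Ph -t00.
rewrite independent_increments2// inc0 -Ph fineM ?fin_num_measure//; last 2 first.
- exact/mXt/ltW.
- exact/mXt/ltW.
rewrite [X in X / _]mulrC mulfK//; rewrite fine_eq0// fin_num_measure//.
exact/mXt/ltW.
Qed.

End Processes.

(** * Merging counting processes *)

Section Rates.
Context d (T : measurableType d) (R : realType) (P : probability T R).
Context (k : nat) (lam : nat -> R) (X : R -> T -> nat).

(* the coefficient of [h] in [Pr{X h = m}] *)
Definition rate (m : nat) : R :=
  if m == 0%N then - \sum_(1 <= i < k.+1) lam i
  else if (m <= k)%N then lam m else 0.

(** The transition conditions are read at [t = 0], [n = 0], where the conditioning event has
    probability one. *)
Lemma GCP_expands : GCP P k lam X ->
  forall m, expands R (fun h => fine (P (X h @^-1` [set m]))) (m == 0%N)%:R (rate m).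
Proof.
move=> [_ [cX X0] indX statX XP] m.
have PX0 : P (X 0 @^-1` [set 0%N]) != 0%E.
  rewrite (_ : _ @^-1` _ = setT) ?probability_setT ?oner_eq0//.
  by apply/seteqP; split=> // w _ /=; rewrite X0.
have tpE j h : 0 < h ->
    transition_prob P X 0 0 j h = fine (P (X h @^-1` [set j])).
  by move=> h0; exact: transition_probE.
have [XP0 XPj XPk] := XP 0 0%N (lexx _) PX0.
rewrite /rate; case: eqP => [->|/eqP m0].
  by apply/(eqo_expands _ _ _ _ _ _).1: XP0 => h h0; rewrite tpE// mulNr.
case: leqP => [mk|km].
  have := XPj m; rewrite lt0n m0 mk => /(_ isT).
  by apply/(eqo_expands _ _ _ _ _ _).1 => h h0; rewrite tpE// add0r.
apply/(eqo_expands _ _ _ _ _ _).1: (XPk m km) => h h0.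
by rewrite tpE// mul0r addr0 subr0.
Qed.

(** For [h > 0] the transition probabilities depend on neither [t] nor [n], so the expansions of the
    law of [X h] give all the conditions. *)
Lemma expands_GCP : (0 < k)%N -> (forall j, (1 <= j <= k)%N -> 0 < lam j) ->
    counting_process X -> (forall w, X 0 w = 0%N) ->
    independent_increments P X -> stationary_increments P X ->
    (forall m, expands R (fun h => fine (P (X h @^-1` [set m])))
      (m == 0%N)%:R (rate m)) ->
  GCP P k lam X.
Proof.
move=> k0 lam0 cX X0 indX statX Xexp; split=> // t n t0 PXt.
have tpE j h : 0 < h ->
    transition_prob P X t n j h = fine (P (X h @^-1` [set j])).
  by move=> h0; exact: transition_probE.
split=> [|j /andP[j0 jk]|j kj].
- apply/(eqo_expands _ _ _ _ _ _).2: (Xexp 0%N) => h h0.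
  by rewrite tpE// /rate eqxx mulNr.
- apply/(eqo_expands _ _ _ _ _ _).2: (Xexp j) => h h0.
  by rewrite tpE// /rate gtn_eqF// jk add0r.
- apply/(eqo_expands _ _ _ _ _ _).2: (Xexp j) => h h0.
  by rewrite tpE// /rate gtn_eqF ?(leq_trans _ kj)// leqNgt kj mul0r addr0 subr0.
Qed.

End Rates.

(** For [m = 0] the sums over processes and amplitudes are exchanged; for [m > 0] the vanishing of
    [rate] beyond [k i] encodes the condition [m <= k i]. *)
Lemma rate_sum (R : realType) (I : finType) (k : I -> nat) (lam : I -> nat -> R)
    (K : nat) (beta : nat -> R) :
    (forall i, (k i <= K)%N) ->
    (forall j, (1 <= j <= K)%N -> beta j = \sum_(i | (j <= k i)%N) lam i j) ->
  forall m, rate R K beta m = \sum_i rate R (k i) (lam i) m.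
Proof.
move=> kK betaE m; rewrite /rate; case: eqP => [_|/eqP m0].
  rewrite sumrN; congr (- _).
  rewrite (eq_big_nat _ _ (F2 := fun j => \sum_i if (j <= k i)%N then lam i j else 0)).
    rewrite exchange_big/=; apply: eq_bigr => i _.
    by rewrite [RHS](big_nat_widen _ _ K.+1) ?ltnS// [RHS]big_mkcond.
  by move=> j jK; rewrite betaE// -big_mkcond.
case: leqP => [mK|Km]; first by rewrite betaE ?lt0n ?m0// big_mkcond.
by rewrite big1// => i _; rewrite leqNgt (leq_ltn_trans (kK i) Km).
Qed.

Section Merging.
Context d (T : measurableType d) (R : realType) (P : probability T R).
Context (I : finType) (M : I -> R -> T -> nat).
Hypothesis M_counting : forall i, counting_process (M i).

Let N (t : R) (w : T) : nat := (\sum_i M i t w)%N.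

Lemma measurable_sumn (Y : I -> T -> nat) :
    (forall i, measurable_fun setT (Y i)) ->
  measurable_fun setT (fun w => \sum_i Y i w)%N.
Proof.
move=> mY _ B _; rewrite setTI.
rewrite (_ : _ @^-1` B = (fun w => [ffun p => Y p w]) @^-1`
    [set u : {ffun I -> nat} | B (\sum_p u p)%N]); last first.
  apply/funext => w /=; congr (B _).
  by apply: eq_bigr => p _; rewrite ffunE.
have mfiber (u : {ffun I -> nat}) :
    measurable ((fun w => [ffun p => Y p w]) @^-1` [set u]).
  rewrite (bigcap_preimage_ffun _ _ _ unit (fun p _ => Y p) u tt).
  apply: fin_bigcap_measurable => [|p _]; first exact: finite_finset.
  by rewrite -[X in measurable X]setTI; exact: mY.
have [A [mA _ ->]] := preimage_countable_disjoint_unions _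
  [set u : {ffun I -> nat} | B (\sum_p u p)%N] measurable measurable0 mfiber.
exact: bigcup_measurable.
Qed.

Lemma counting_process_sum : counting_process N.
Proof.
split=> [t t0|w s t s0 st|w t t0].
- by apply: measurable_sumn => i; have [mM _ _] := M_counting i; exact: mM.
- by apply: leq_sum => i _; have [_ ndecM _] := M_counting i; exact: ndecM.
(* In the discrete space [nat], right-continuity means being locally constant on the right, which
   passes to finitely many summands at once. *)
apply: cvg_near_cst.
have : \forall s \near t^'+, forall i, M i s w = M i t w.
  apply: filter_forall => i; have [_ _ rcM] := M_counting i.
  exact: (rcM w t t0 _ (discrete_set1 _)).
by apply: filterS => s Ms; apply: eq_bigr => i _.
Qed.

Lemma increment_sum (s t : R) : 0 <= s -> s <= t ->
  increment N s t = (fun w => \sum_i increment (M i) s t w)%N.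
Proof.
move=> s0 st; apply/funext => w; rewrite /increment sumnB// => i _.
by have [_ ndecM _] := M_counting i; exact: ndecM.
Qed.

Hypothesis M_indep : independent_processes P M.

Lemma independent_increments_sum : (0 < #|I|)%N ->
    (forall i, independent_increments P (M i)) ->
  independent_increments P N.
Proof.
move=> I0 M_ii n t t0 t_incr.
have t_ge0 i : (i <= n)%N -> 0 <= t i.
  elim: i => // i IH ni; apply/ltW/(le_lt_trans (IH (ltnW ni))).
  exact: t_incr.
have -> : (fun i : 'I_n =>
      preimage_set_system setT (increment N (t i) (t i.+1)) measurable) =
    (fun i : 'I_n => preimage_set_system setT
      (fun w => \sum_p increment (M p) (t i) (t i.+1) w)%N measurable).
  apply/funext => i; rewrite increment_sum//; first exact/t_ge0/ltnW.
  exact/ltW/t_incr.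
apply: (sum_independent _ _ _ _ _ _ (fun p (i : 'I_n) => increment (M p) (t i) (t i.+1))
  (fun p => process_sigma_algebra (M p))) => //.
- move=> p K C; apply: process_sigma_algebra_bigcap => i.
  by apply: process_sigma_algebra_increment; apply: t_ge0 => //; exact: ltnW.
- by move=> p; exact: M_ii.
- move=> p i; have [mM _ _] := M_counting p.
  by apply: measurable_increment; apply: mM; apply: t_ge0 => //; exact: ltnW.
Qed.

(** The law of the vector of increments is determined by its one-point events, whose probabilities
    factor by independence into stationary factors. *)
Lemma stationary_increments_sum : (forall i, stationary_increments P (M i)) ->
  stationary_increments P N.
Proof.
move=> M_si s t h s0 t0 h0 B _; rewrite /pushforward.
have sum_ffun r : 0 <= r -> increment N r (r + h) @^-1` B =
    (fun w => [ffun p => increment (M p) r (r + h) w]) @^-1`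
    [set u : {ffun I -> nat} | B (\sum_p u p)%N].
  move=> r0; rewrite increment_sum ?lerDl//; apply/funext => w /=; congr (B _).
  by apply: eq_bigr => p _; rewrite ffunE.
have fiberE r (u : {ffun I -> nat}) :=
  bigcap_preimage_ffun _ T I unit (fun p _ => increment (M p) r (r + h)) u tt.
have inc_sigma r p (u : {ffun I -> nat}) : 0 <= r -> process_sigma_algebra (M p)
    (increment (M p) r (r + h) @^-1` [set u p]).
  by move=> r0; apply: process_sigma_algebra_increment => //; exact: addr_ge0.
have mfiber r (u : {ffun I -> nat}) : 0 <= r -> measurable
    ((fun w => [ffun p => increment (M p) r (r + h) w]) @^-1` [set u]).
  move=> r0; rewrite fiberE; apply: fin_bigcap_measurable => [|p _].
    exact: finite_finset.
  rewrite -[X in measurable X]setTI; have [mM _ _] := M_counting p.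
  by apply: measurable_increment => //; apply: mM; rewrite ?addr_ge0.
rewrite !sum_ffun//; apply: eq_probability_preimage => u; [exact: mfiber..|].
rewrite !fiberE !M_indep; [|by move=> p _; exact: inc_sigma..].
apply: eq_bigr => p _.
exact: (M_si p s t h s0 t0 h0 [set u p]).
Qed.

Lemma expands_sum_process (c : I -> nat -> R) :
    (forall i m, expands R (fun h => fine (P (M i h @^-1` [set m])))
      (m == 0%N)%:R (c i m)) ->
  forall m, expands R (fun h => fine (P (N h @^-1` [set m]))) (m == 0%N)%:R
    (\sum_i c i m).
Proof.
move=> Mexp m.
pose G p (h : R) := \poly_(a < m.+1) fine (P (M p h @^-1` [set a])).
have Gexp p i : (i <= m)%N ->
    expands R (fun h => (G p h)`_i) (i == 0%N)%:R (c p i).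
  by move=> im; under eq_fun do rewrite coef_poly ltnS im; exact: Mexp.
have GE : {near 0^'+, (fun h => (\prod_p G p h)`_m) =1
    (fun h => fine (P (N h @^-1` [set m])))}.
  apply: filterS (nbhs_right_gt 0) => h h0.
  rewrite (probability_sum_coef _ _ _ _ _ (fun p => M p h) _ _ m m)//.
    by move=> p; have [mM _ _] := M_counting p; exact/mM/ltW.
  by move=> u; apply: M_indep => p _;
    apply: process_sigma_algebra_preimage; exact: ltW.
have := expands_coef_prod R I (index_enum I) G c m Gexp m (leqnn m).
rewrite /expands; apply: cvg_trans; apply: near_eq_cvg.
by apply: filterS GE => h ->.
Qed.

End Merging.

(* The indices 1, ..., q of the processes are [i.+1] for [i : 'I_q]. *)
Theorem mainTheorem2 (d : measure_display) (T : measurableType d)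
  (R : realType) (P : probability T R)
  (q : nat) (q_gt0 : (0 < q)%N)
  (k : 'I_q -> nat) (lam : 'I_q -> nat -> R) (M : 'I_q -> R -> T -> nat)
  (k_nondecreasing : forall i j : 'I_q, (i <= j)%N -> (k i <= k j)%N)
  (M_GCP : forall i : 'I_q, GCP P (k i) (lam i) (M i))
  (M_indep : independent_processes P M)
  (beta : nat -> R)
  (betaE : forall m j : nat, (1 <= m <= nb_distinct k)%N ->
     (kval k m.-1 + 1 <= j <= kval k m)%N ->
     beta j = \sum_(i < q | (rindex k m.-1 <= i.+1)%N) lam i j) :
  GCP P (kval k (nb_distinct k)) beta
    (fun (t : R) (w : T) => (\sum_(i < q) M i t w)%N).
Proof.
have k_gt0 i : (0 < k i)%N by have [[]] := M_GCP i.
have lam_gt0 i j : (1 <= j <= k i)%N -> 0 < lam i j.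
  by have [[_]] := M_GCP i => + _ _ _ _; apply.
have M_counting i : counting_process (M i) by have [_ []] := M_GCP i.
have kval_max i : (k i <= kval k (nb_distinct k))%N by exact: leq_kval_nb.
have betaE' := merged_rateE q k k_gt0 R lam beta k_nondecreasing betaE.
have nb_gt0 := nb_distinct_gt0 q k q_gt0.
(* A process [i0] with the largest amplitude contributes to every [beta j], which makes all these
   rates positive. *)
have [|i0 i0E] := kval_codom q k (nb_distinct k); first by rewrite nb_gt0 leqnn.
apply: expands_GCP.
- by rewrite -i0E.
- move=> j /andP[j0 jk]; rewrite betaE' ?j0// (bigD1 i0) ?i0E//=.
  rewrite ltr_pwDl ?lam_gt0 ?j0 ?i0E// sumr_ge0// => i /andP[ji _].
  by rewrite ltW ?lam_gt0 ?j0.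
- exact: counting_process_sum.
- by move=> w; rewrite big1// => i _; have [_ []] := M_GCP i.
- apply: independent_increments_sum => //; first by rewrite card_ord.
  by move=> i; have [] := M_GCP i.
- by apply: stationary_increments_sum => // i; have [] := M_GCP i.
- move=> m; rewrite (rate_sum _ _ k lam)//.
  apply: (expands_sum_process _ _ _ _ _ M M_counting M_indep
    (fun i => rate R (k i) (lam i))) => i.
  exact: GCP_expands.
Qed.
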